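(* Let $K \ge 2$ and $d \ge 1$ be integers, and let $T_1,\ldots,T_{K-1}, D > 0$ be real numbers. Suppose $\lambda^* \in \mathcal{F}_K(T_1,\ldots,T_{K-1};D)$ achieves the maximum of $\lambda_1$ over $\mathcal{F}_K(T_1,\ldots,T_{K-1};D)$, i.e. $\lambda_1^* = B_K^+$. Then $\lambda^*$ takes at most $K$ distinct values (i.e. the set of its coordinates has at most $K$ elements).
   Context: $\mathcal{F}_K(T_1,\ldots,T_{K-1};D) := \{\lambda \in \mathbb{R}^d_{>0} : \sum_{i=1}^d \lambda_i^k = T_k \text{ for } k = 1,\ldots,K-1,\ \prod_{i=1}^d \lambda_i = D\}$ and $B_K^+ := \max\{\lambda_1 : \lambda \in \mathcal{F}_K(T_1,\ldots,T_{K-1};D)\}$. *)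

(* Defs.v *)
From HB Require Import structures.
From mathcomp Require Import all_boot all_order all_algebra.
From mathcomp Require Import classical_sets reals.

Set Implicit Arguments.
Unset Strict Implicit.
Unset Printing Implicit Defensive.

Import Order.TTheory GRing.Theory Num.Theory.

Local Open Scope classical_set_scope.
Local Open Scope ring_scope.

(* Only the entries T k with 1 <= k < K matter. *)
Definition feasible (R : realType) (d K : nat) (T : nat -> R) (D : R) :
    set 'rV[R]_d :=
  [set lam : 'rV[R]_d |
    [/\ forall i : 'I_d, 0 < lam 0 i,
        forall k : nat, (1 <= k < K)%N -> \sum_(i < d) lam 0 i ^+ k = T k
      & \prod_(i < d) lam 0 i = D]].

Definition is_maximum (R : realType) (A : set R) (m : R) : Prop :=
  A m /\ (forall x, A x -> x <= m).

(* [b] is B_K^+; the proof of [0 < d] makes index 0, that is lambda_1,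
   available. *)
Definition is_Bplus (R : realType) (d : nat) (hd : (0 < d)%N) (K : nat)
    (T : nat -> R) (D : R) (b : R) : Prop :=
  is_maximum
    [set lam 0 (Ordinal hd) | lam in @feasible R d K T D] b.

Definition num_distinct_values (R : realType) (d : nat) (lam : 'rV[R]_d) : nat :=
  size (undup [seq lam 0 i | i : 'I_d]).

(* Main.v *)
(** If [lam] took more than K values, choose K + 1 coordinates with distinct
    values x_0, ..., x_K, among them x_0 = lam_1, and put P = prod_i (X - x_i).
    The polynomial P + t X has the same coefficients as P except in degree 1,
    so by Newton's identities its roots have the same power sums of exponents
    k < K and the same product. For small t the intermediate value theorem
    gives it K + 1 distinct positive real roots near the x_i, and the sign of t
    can be chosen so that the root near x_0 exceeds x_0. Replacing the x_i by
    these roots gives a feasible point with a larger first coordinate. *)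
Require Import Defs.
From HB Require Import structures.
From mathcomp Require Import all_boot all_order all_algebra.
From mathcomp Require Import classical_sets reals.
From mathcomp Require Import polyrcf zify ring lra.

Set Implicit Arguments.
Unset Strict Implicit.
Unset Printing Implicit Defensive.

Import Order.TTheory GRing.Theory Num.Theory.

Local Open Scope classical_set_scope.
Local Open Scope ring_scope.

(** * Newton's identities: power sums and product of the roots from the coefficients *)

Lemma deriv_prod_XsubC (F : fieldType) (rs : seq F) :
  let P := \prod_(z <- rs) ('X - z%:P) in
  P^`() = \sum_(z <- rs) P %/ ('X - z%:P).
Proof.
elim: rs => [|r rs IH] /=; first by rewrite !big_nil derivC.
rewrite !big_cons derivM derivXsubC mul1r mulKp ?polyXsubC_eq0 //.
congr (_ + _); rewrite IH mulr_sumr; apply: eq_big_seq => z zrs.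
rewrite divp_mulA // dvdp_XsubCl root_prod_XsubC //.
Qed.

(** As P(z) = 0, P = P - P(z) is the sum of the P_m (X^m - z^m), and each X^m - z^m is X - z times a
    geometric sum. *)
Lemma divp_XsubC_root (F : fieldType) (P : {poly F}) (z : F) : root P z ->
  P %/ ('X - z%:P) =
  \sum_(m < size P) P`_m *: \sum_(i < m) z ^+ i *: 'X^(m.-1 - i).
Proof.
set G := RHS => /eqP Pz0.
suff {1}-> : P = ('X - z%:P) * G by rewrite mulKp ?polyXsubC_eq0.
rewrite -[LHS]subr0 -polyC0 -Pz0 [in LHS]horner_coef -{1}[P]coefK poly_def.
rewrite rmorph_sum -sumrB mulr_sumr.
apply: eq_bigr => m _; rewrite -scalerAr rmorphM rmorphXn /= mul_polyC.
rewrite -scalerBr subrXX; congr (_ *: (_ * _)).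
by apply: eq_bigr => i _; rewrite -rmorphXn mulrC mul_polyC.
Qed.

(* Newton's identities in coefficient form: the right-hand side is
   [\sum_(m > a) P`_m * s_(m - 1 - a)] with [s_i] the i-th power sum. *)
Lemma coef_deriv_prod_XsubC (F : fieldType) (rs : seq F) (a : nat) :
  let P := \prod_(z <- rs) ('X - z%:P) in
  P^`()`_a = \sum_(m < (size rs).+1) P`_m *
    \sum_(i < m | (m.-1 - i == a)%N) \sum_(z <- rs) z ^+ i.
Proof.
move=> P; rewrite {1}/P deriv_prod_XsubC -/P coef_sum.
under eq_big_seq => z zrs.
  rewrite divp_XsubC_root ?root_prod_XsubC // size_prod_XsubC coef_sum.
  over.
rewrite exchange_big /=; apply: eq_bigr => m _.
under eq_bigr => z _ do rewrite coefZ coef_sum.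
rewrite -mulr_sumr exchange_big /= [in RHS]big_mkcond /=.
congr (_ * _); apply: eq_bigr => i _; rewrite eq_sym.
case: ifP => e; under eq_bigr => z _ do rewrite coefZ coefXn e ?mulr1 ?mulr0.
  by [].
by rewrite big1.
Qed.

(** Strong induction on k. With n = [size rs], compare Newton's identities in degree n - 1 - k: the
    term m = n is the k-th power sum with coefficient 1, and the other terms involve only smaller
    exponents and coefficients of index above l. *)
Lemma eq_power_sums (F : fieldType) (rs rs' : seq F) (l : nat) :
  let P := \prod_(z <- rs) ('X - z%:P) in
  let Q := \prod_(z <- rs') ('X - z%:P) in
  size rs = size rs' -> (forall m, (l < m)%N -> P`_m = Q`_m) ->
  forall k, (k + l < size rs)%N ->
  \sum_(z <- rs) z ^+ k = \sum_(z <- rs') z ^+ k.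
Proof.
move=> P Q sz PQ; elim/ltn_ind => k IH klt.
have lea : (l <= (size rs).-1 - k)%N by lia.
have lead (ss : seq F) : (\prod_(z <- ss) ('X - z%:P))`_(size ss) = 1.
  have /monicP := monic_prod_XsubC ss xpredT id.
  by rewrite lead_coefE size_prod_XsubC.
have := coef_deriv_prod_XsubC rs' ((size rs).-1 - k).
rewrite /= -/Q coef_deriv -PQ // -coef_deriv coef_deriv_prod_XsubC -/P -sz.
have Pn : P`_(size rs) = 1 by exact: lead.
have Qn : Q`_(size rs) = 1 by rewrite sz; exact: lead.
rewrite !big_ord_recr /= Pn Qn !mul1r.
rewrite (eq_bigr (fun m : 'I_(size rs) => Q`_m *
    \sum_(i < m | (m.-1 - i == (size rs).-1 - k)%N) \sum_(z <- rs') z ^+ i)).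
  move=> /addrI; have kn : (k < size rs)%N by lia.
  rewrite !(big_pred1 (Ordinal kn)) // => i;
    by rewrite -[RHS]val_eqE /=; have := ltn_ord i; lia.
move=> m _; have mn := ltn_ord m.
have [lm|] := ltnP l m.
  rewrite PQ //; congr (_ * _); apply: eq_bigr => i /eqP e.
  by apply: IH; have := ltn_ord i; lia.
(* For m <= l the inner sum is empty, since m - 1 - i < l <= n - 1 - k. *)
move=> ml; rewrite !big_pred0 ?mulr0 // => i; have := ltn_ord i; lia.
Qed.

Lemma eq_prod_roots (F : fieldType) (rs rs' : seq F) :
  let P := \prod_(z <- rs) ('X - z%:P) in
  let Q := \prod_(z <- rs') ('X - z%:P) in
  size rs = size rs' -> P`_0 = Q`_0 ->
  \prod_(z <- rs) z = \prod_(z <- rs') z.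
Proof.
have coef0 (ss : seq F) : (\prod_(z <- ss) ('X - z%:P))`_0 =
    (-1) ^+ size ss * \prod_(z <- ss) z.
  elim: ss => [|s ss IH]; first by rewrite !big_nil coef1 mulr1.
  by rewrite !big_cons coef0M IH coefB coefX coefC /= sub0r exprS; ring.
move=> P Q sz; rewrite !coef0 sz.
by apply: mulfI; rewrite signr_eq0.
Qed.

(** * Perturbing the polynomial *)

Lemma exists_pos_lt (R : realFieldType) (I : finType) (F : I -> R) :
  (forall i, 0 < F i) -> exists2 e, 0 < e & forall i, e < F i.
Proof.
move=> F0; suff [e e0 eF] : exists2 e, 0 < e & {in enum I, forall i, e < F i}.
  by exists e => // i; apply: eF; rewrite mem_enum.
elim: (enum I) => [|j s [e e0 eF]]; first by exists 1.
have m0 : 0 < Num.min e (F j) by rewrite lt_min e0 F0.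
exists (Num.min e (F j) / 2); first lra.
have mlt : Num.min e (F j) / 2 < Num.min e (F j) by lra.
move=> i; rewrite in_cons => /orP[/eqP ->|/eF ei].
  by apply: lt_le_trans mlt _; rewrite ge_min lexx orbT.
by apply: lt_trans (lt_le_trans mlt _) ei; rewrite ge_min lexx.
Qed.

Lemma mulr_lt0_perturb (R : realDomainType) (p q s t : R) :
  p * q < 0 -> `|s| < `|p| -> `|t| < `|q| -> (p + s) * (q + t) < 0.
Proof.
rewrite !ltr_norml; have [p0|p0|->] := ltrgt0P p; last by rewrite mul0r ltxx.
  rewrite pmulr_rlt0 // => q0; rewrite (ltr0_norm q0) => /andP[? ?] /andP[? ?].
  rewrite pmulr_rlt0; lra.
rewrite nmulr_rlt0 // => q0; rewrite (gtr0_norm q0) => /andP[? ?] /andP[? ?].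
rewrite nmulr_rlt0; lra.
Qed.

(** Here n stands for K - 1, so there are K + 1 points. *)
Lemma increase_one_root (R : rcfType) (n : nat) (x : 'I_n.+2 -> R) :
  injective x -> (forall i, 0 < x i) ->
  exists y : 'I_n.+2 -> R,
    [/\ forall i, 0 < y i,
        forall k, (k <= n)%N -> \sum_i y i ^+ k = \sum_i x i ^+ k,
        \prod_i y i = \prod_i x i
      & x ord0 < y ord0].
Proof.
move=> xI x0.
(* Diagonal pairs keep the intervals [x_i - d, x_i + d] positive; the other pairs keep them
   disjoint. *)
have [d d0 dlt] : exists2 d, 0 < d & forall p : 'I_n.+2 * 'I_n.+2,
    d < if p.1 == p.2 then x p.1 else `|x p.1 - x p.2| / 2.
  apply: exists_pos_lt => -[i j] /=; case: eqVneq => // ij.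
  by rewrite divr_gt0 // normr_gt0 subr_eq0 inj_eq.
have dx i : d < x i by have := dlt (i, i); rewrite /= eqxx.
have dxx i j : i != j -> d *+ 2 < `|x i - x j|.
  by move=> ij; have := dlt (i, j); rewrite /= (negPf ij); lra.
pose P := \prod_(z <- [seq x i | i : 'I_n.+2]) ('X - z%:P).
have PE u : P.[u] = \prod_i (u - x i).
  by rewrite /P big_image /= horner_prod; under eq_bigr do rewrite hornerXsubC.
(* Only the factor u - x_j changes sign between x_j - d and x_j + d. *)
have Psgn j : P.[x j - d] * P.[x j + d] < 0.
  rewrite !PE -big_split (bigD1 j) //= nmulr_rlt0; last by nra.
  apply: prodr_gt0 => i ij; rewrite eq_sym in ij; have := dxx _ _ ij.
  rewrite lter_normr => /orP[]; nra.
pose pt (p : 'I_n.+2 * bool) := if p.2 then x p.1 + d else x p.1 - d.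
have pt0 p : 0 < pt p by rewrite /pt; case: p.2; have := dx p.1; lra.
have Ppt p : P.[pt p] != 0.
  have := Psgn p.1; rewrite /pt; apply: contraTneq.
  by case: p.2 => ->; rewrite ?mul0r ?mulr0 ltxx.
(* With |t| = e, adding t X preserves the sign of P at every endpoint [pt p]. *)
have [e e0 eP] : exists2 e, 0 < e & forall p, e < `|P.[pt p]| / pt p.
  by apply: exists_pos_lt => p; rewrite divr_gt0 ?normr_gt0.
(* Q(x_0) = t x_0 must have the sign opposite to P(x_0 + d), which forces a root of Q to the right
   of x_0. *)
pose t := - Num.sg P.[x ord0 + d] * e.
have te : `|t| = e.
  by rewrite normrM normrN normr_sg (Ppt (ord0, true)) mul1r gtr0_norm.
have tpt p : `|pt p * t| < `|P.[pt p]|.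
  by rewrite normrM te gtr0_norm // mulrC -ltr_pdivlMr.
pose Q := P + t *: 'X.
have QE u : Q.[u] = P.[u] + u * t by rewrite hornerD hornerZ hornerX mulrC.
have Qsgn j : Q.[x j - d] * Q.[x j + d] < 0.
  rewrite !QE; apply: mulr_lt0_perturb; first exact: Psgn.
    exact: (tpt (j, false)).
  exact: (tpt (j, true)).
have Qsgn0 : Q.[x ord0] * Q.[x ord0 + d] < 0.
  have Px0 : P.[x ord0] = 0.
    by rewrite PE (bigD1 ord0) //= subrr mul0r.
  have v0 := Ppt (ord0, true); have tv := tpt (ord0, true).
  rewrite !QE Px0 add0r -[x ord0 * t]addr0.
  apply: mulr_lt0_perturb => //.
    rewrite -mulrA pmulr_rlt0 // /t !mulNr oppr_lt0 mulrAC -normrEsg.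
    by rewrite mulr_gt0 ?normr_gt0.
  rewrite normr0 normr_gt0 mulf_neq0 ?(gt_eqF (x0 _)) //.
  by rewrite -normr_gt0 te.
have root_ex j : exists y, [/\ root Q y, x j - d < y < x j + d
    & j = ord0 -> x ord0 < y].
  have [->|j0] := eqVneq j ord0.
    have [|y] := poly_ivtoo _ Qsgn0; first lra.
    by rewrite in_itv /= => /andP[? ?] ry; exists y; split => //; lra.
  have [|y] := poly_ivtoo _ (Qsgn j); first lra.
  by rewrite in_itv /= => yI ry; exists y; split => // /eqP; rewrite (negPf j0).
have [y yP] : exists y : 'I_n.+2 -> R, forall j, [/\ root Q (y j),
    x j - d < y j < x j + d & j = ord0 -> x ord0 < y j].
  exact: (fin_all_exists root_ex).
have yI : injective y.
  move=> i j yij; apply: contraTeq isT => ij.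
  have [_ /andP[? ?] _] := yP i; have [_ /andP[? ?] _] := yP j.
  have := dxx _ _ ij; rewrite lter_normr => /orP[]; lra.
have szP : size P = n.+3 by rewrite size_prod_XsubC size_map -cardE card_ord.
(* P has degree at least 2, so P + t X stays monic of the same degree; its n + 2 distinct roots then
   give the full factorization. *)
have szt : (size (t *: 'X : {poly R}) < size P)%N.
  by rewrite szP (leq_ltn_trans (size_scale_leq _ _)) // size_polyX.
have QP : Q = \prod_(z <- [seq y i | i : 'I_n.+2]) ('X - z%:P).
  rewrite [LHS](@all_roots_prod_XsubC _ _ [seq y i | i : 'I_n.+2]).
  - by rewrite lead_coefDl // (monicP (monic_prod_XsubC _ _ _)) scale1r.
  - by rewrite size_polyDl // szP size_map -cardE card_ord.
  - by apply/allP => _ /mapP[i _ ->]; case: (yP i).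
  - by rewrite uniq_rootsE map_inj_uniq ?enum_uniq.
have szxy : size [seq x i | i : 'I_n.+2] = size [seq y i | i : 'I_n.+2].
  by rewrite !size_map.
exists y; split.
- by move=> i; have [_ /andP[? ?] _] := yP i; have := dx i; lra.
- move=> k kn; have imE (w : 'I_n.+2 -> R) :
      \sum_i w i ^+ k = \sum_(z <- [seq w i | i : 'I_n.+2]) z ^+ k.
    by rewrite big_image.
  rewrite !imE.
  apply/esym/(@eq_power_sums _ _ _ 1 szxy) => [m m1|].
    rewrite -QP coefD coefZ coefX gtn_eqF // mulr0 addr0 //.
  by rewrite size_map -cardE card_ord addn1.
- have imE (w : 'I_n.+2 -> R) :
      \prod_i w i = \prod_(z <- [seq w i | i : 'I_n.+2]) z.
    by rewrite big_image.
  rewrite !imE; apply/esym/(eq_prod_roots szxy).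
  by rewrite -QP coefD coefZ coefX mulr0 addr0.
- by have [_ _ ->] := yP ord0.
Qed.

(** * Selecting and replacing coordinates *)

Lemma choose_distinct_values (R : eqType) (d m : nat) (g : 'I_d -> R)
    (i0 : 'I_d) : (m.+1 < size (undup [seq g i | i : 'I_d]))%N ->
  exists2 f : 'I_m.+2 -> 'I_d, f ord0 = i0 & injective (g \o f).
Proof.
set s := undup _ => ms.
have su : uniq s by exact: undup_uniq.
have s0 : g i0 \in s by rewrite mem_undup map_f ?mem_enum.
(* Moving [g i0] to the front makes index 0 correspond to its value. *)
pose r := g i0 :: rem (g i0) s.
have ru : uniq r by rewrite -(perm_uniq (perm_to_rem s0)).
have szr : size r = size s by rewrite (perm_size (perm_to_rem s0)).
(* The value [g i0] may occur at several indices, so [i0] itself is imposed for j = 0. *)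
have ex (j : 'I_m.+2) : exists i, g i = nth (g i0) r j /\ (j = ord0 -> i = i0).
  have [->|j0] := eqVneq j ord0; first by exists i0.
  have : nth (g i0) r j \in s.
    by rewrite (perm_mem (perm_to_rem s0)) mem_nth // szr (leq_trans _ ms).
  rewrite mem_undup => /mapP[i _ ->]; exists i; split=> // /eqP.
  by rewrite (negPf j0).
have [f fP] := fin_all_exists ex; exists f; first by have [_ ->] := fP ord0.
move=> j k /=; have [-> _] := fP j; have [-> _] := fP k => /eqP.
by rewrite nth_uniq ?szr ?(leq_trans _ ms) // => /eqP/val_inj.
Qed.

Definition replace_along (R : Type) (n d : nat) (f : 'I_n -> 'I_d)
    (y : 'I_n -> R) (g : 'I_d -> R) (i : 'I_d) : R :=
  if [pick j | f j == i] is Some j then y j else g i.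

Lemma replace_along_in (R : Type) (n d : nat) (f : 'I_n -> 'I_d)
    (y : 'I_n -> R) (g : 'I_d -> R) (j : 'I_n) :
  injective f -> replace_along f y g (f j) = y j.
Proof.
move=> fI; rewrite /replace_along; case: pickP => [k /eqP/fI -> //|].
by move=> /(_ j); rewrite eqxx.
Qed.

(** Split the indices by membership in the image of f: outside it nothing changes, and on it
    injectivity reindexes by j. The general operator serves both the power sums and the product. *)
Lemma big_replace_along (R S : Type) (idx : S) (op : Monoid.com_law idx)
    (n d : nat) (f : 'I_n -> 'I_d) (y : 'I_n -> R) (g : 'I_d -> R)
    (F : R -> S) : injective f ->
  \big[op/idx]_j F (y j) = \big[op/idx]_j F (g (f j)) ->
  \big[op/idx]_i F (replace_along f y g i) = \big[op/idx]_i F (g i).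
Proof.
move=> fI yg; rewrite (bigID (mem (f @: 'I_n))) [RHS](bigID (mem (f @: 'I_n))).
congr (op _ _).
  rewrite !big_imset /=; try by move=> ? ? _ _; exact: fI.
  rewrite (eq_bigr (fun j => F (y j))) => [|j _]; last first.
    by rewrite replace_along_in.
  exact: yg.
apply: eq_bigr => i /imsetP ni; rewrite /replace_along; case: pickP => //.
by move=> j /eqP fj; case: ni; exists j.
Qed.

Theorem theorem5p1 (R : realType) (K d : nat) (hK : (2 <= K)%N)
    (hd : (1 <= d)%N) (T : nat -> R) (D : R)
    (hT : forall k : nat, (1 <= k < K)%N -> 0 < T k) (hD : 0 < D)
    (B : R) (hB : is_Bplus hd K T D B)
    (lam : 'rV[R]_d) (hlam : feasible K T D lam)
    (hmax : lam 0 (Ordinal hd) = B) :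
  (num_distinct_values lam <= K)%N.
Proof.
rewrite leqNgt; apply/negP; case: K hK hT hB hlam => [//|m] _ _ hB hlam many.
case: hB hlam => _ hB [lam0 lamT lamD].
have [f f0 gfI] := choose_distinct_values (Ordinal hd) many.
have fI : injective f := inj_compr gfI.
have [y [y0 yT yD ylt]] := increase_one_root gfI (fun j => lam0 (f j)).
pose mu : 'rV[R]_d := \row_i replace_along f y (lam 0) i.
suff /hB : [set l 0 (Ordinal hd) | l in feasible m.+1 T D] (mu 0 (Ordinal hd)).
  rewrite mxE -hmax -f0 replace_along_in // leNgt.
  by rewrite /= in ylt; rewrite ylt.
exists mu => //; split.
- move=> i; rewrite mxE /replace_along; case: pickP => // j _; exact: y0.
- move=> k /andP[k1 kK]; rewrite -lamT ?k1 //; under eq_bigr do rewrite mxE.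
  by apply: (@big_replace_along R R _ _ _ _ f y (lam 0) (fun z => z ^+ k)) => //; exact: yT.
- rewrite -lamD; under eq_bigr do rewrite mxE.
  exact: (@big_replace_along R R _ _ _ _ f y (lam 0) id).
Qed.
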